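(* Let $d$ be prime and consider a family, indexed by $n\to\infty$, of qudit stabilizer codes with $k_n$ logical qudits subject to stochastic Weyl noise channels, with AQEC relative entropies $S_n=S(\Lambda_n+B_n\|\Lambda_n)$ and maximum-likelihood-decoder success probabilities $P_{\mathrm{succ},n}=\sum_{s}\max_{l}\Pr_n(s,l)$. Then: (1) If $\lim_{n\to\infty}S_n=0$, then $\lim_{n\to\infty}P_{\mathrm{succ},n}=1$. (2) If $k_n=O(1)$ and $\lim_{n\to\infty}P_{\mathrm{succ},n}=1$, then $\lim_{n\to\infty}S_n=0$. (3) If $k_n\to\infty$ and $\lim_{n\to\infty}P_{\mathrm{succ},n}=1$, then $S_n/k_n\to0$.
   Context: For each $n$: $\mathcal V=\mathbb Z_d^{2n}$ with standard symplectic form; $T(v)$ the Heisenberg–Weyl operators on $n$ qudits; $\mathcal M\subseteq\mathcal V$ isotropic with stabilizer group $T(\mathcal M)$ (abelian, no nontrivial scalars), code space its common $+1$ eigenspace, $k_n=n-\dim\mathcal M$, $K=d^{k_n}$. Fix $\mathcal L$ with $\mathcal M^\perp=\mathcal L\oplus\mathcal M$ and $\mathcal S$ with $\mathcal V=\mathcal S\oplus\mathcal M^\perp$. Noise: $\mathcal N_n(\rho)=\sum_\eta\Pr_n(\eta)T(\eta)\rho T(\eta)^\dagger$ with Kraus operators $\sqrt{\Pr_n(\eta)}T(\eta)$; $\Pr_n(s,l)=\sum_{m\in\mathcal M}\Pr_n(s+l+m)$. AQEC relative entropy: with $P$ the code projector and orthonormal code basis $\{|q\rangle\}$, $PE_u^\dagger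 E_vP=\lambda_{uv}P+PB_{uv}P$, $\lambda_{uv}=\frac1K\mathrm{tr}(PE_u^\dagger E_vP)$, $\Lambda_{uv,q_1q_2}=\lambda_{uv}\delta_{q_1q_2}/K$, $B_{uv,q_1q_2}=\langle q_1|B_{uv}|q_2\rangle/K$ (rows $(u,q_1)$, columns $(v,q_2)$), $S(\Lambda+B\|\Lambda)=\mathrm{tr}\{(\Lambda+B)[\log(\Lambda+B)-\log\Lambda]\}$. *)

(* Defs.v *)
(* + MathComp-Analysis (ln, cos, sin, pi, limits) +
   real_closed complex numbers R[i]; spectral theorem from mathcomp/algebra. *)
From HB Require Import structures.
From mathcomp Require Import all_boot all_order all_algebra.
From mathcomp Require Import spectral sesquilinear.
From mathcomp Require Import complex.
From mathcomp Require Import all_classical all_reals exp trigo topology normedtype sequences.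

Set Implicit Arguments.
Unset Strict Implicit.
Unset Printing Implicit Defensive.

Import Order.TTheory GRing.Theory Num.Theory.
Local Open Scope ring_scope.

Section QECDefs.

Variable R : realType.
Local Notation C := R[i].
Local Open Scope complex_scope.
Variable d : nat.

(* Phase space  V = Z_d^{2n}, written as pairs (x, z) of row vectors. *)
Definition V (n : nat) := ('rV['F_d]_n * 'rV['F_d]_n)%type.

Definition dotF n (a b : 'rV['F_d]_n) : 'F_d := (a *m b^T) 0 0.

(* standard symplectic form  <(x,z),(x',z')> = x.z' - z.x' *)
Definition symp n (u v : V n) : 'F_d := dotF u.1 v.2 - dotF u.2 v.1.

Definition vadd n (u v : V n) : V n := (u.1 + v.1, u.2 + v.2).
Definition vscale n (a : 'F_d) (u : V n) : V n := (a *: u.1, a *: u.2).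
Definition v0 n : V n := (0, 0).

(* linear subspace of V *)
Definition is_subspace n (A : {set V n}) : bool :=
  [&& v0 n \in A,
      [forall u in A, forall v in A, vadd u v \in A] &
      [forall a : 'F_d, forall u in A, vscale a u \in A]].

Definition sperp n (A : {set V n}) : {set V n} :=
  [set v | [forall m in A, symp v m == 0]].

Definition isotropic n (A : {set V n}) : bool := A \subset sperp A.

(* internal direct sum  C = A (+) B  of subspaces *)
Definition is_dsum n (A B Cs : {set V n}) : bool :=
  [&& is_subspace A, is_subspace B,
      A :&: B == [set v0 n] &
      Cs == [set vadd a b | a in A, b in B]].

(* dimension of a subspace (its cardinality is d ^ dim) and k = n - dim M *)
Definition sdim n (A : {set V n}) : nat := logn d #|A|.
Definition kdim n (M : {set V n}) : nat := (n - sdim M)%N.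

(* Hilbert space of n qudits: C^(d^n), computational basis labelled by
   y in F_d^n (encoded via enum_val). *)
Definition Hs (n : nat) : nat := #|{: 'rV['F_d]_n}|.

Definition omega : C := ((cos (2 * pi / d%:R)) +i* (sin (2 * pi / d%:R)))%C.

(* Heisenberg-Weyl operator T(x,z) = Z^z X^x :
   T(x,z)|y> = omega^{z.(y+x)} |y+x>. *)
Definition weyl n (v : V n) : 'M[C]_(Hs n) :=
  \matrix_(i, j)
    (let y' : 'rV['F_d]_n := enum_val i in
     let y  : 'rV['F_d]_n := enum_val j in
     if y' == y + v.1 then omega ^+ (val (dotF v.2 y')) else 0).

Local Open Scope sesquilinear_scope.

(* A stabilizer code: M isotropic subspace and the stabilizer group T(M)
   (with phases c(m), |c(m)| = 1, fixed so that m |-> c(m) T(m) is a group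
   homomorphism on M: abelian, no nontrivial scalars). *)
Definition stab_group n (M : {set V n}) (c : V n -> C) : Prop :=
  is_subspace M /\ isotropic M /\
  (forall m, m \in M -> `|c m| = 1) /\
  (forall m m', m \in M -> m' \in M ->
     (c m *: weyl m) *m (c m' *: weyl m') = c (vadd m m') *: weyl (vadd m m')).

(* The columns of W form an orthonormal basis of the code space, i.e. of the
   common +1 eigenspace of the stabilizer group. *)
Definition code_basis n (M : {set V n}) (c : V n -> C) K (W : 'M[C]_(Hs n, K)) : Prop :=
  W ^t* *m W = 1%:M /\
  (forall psi : 'cV[C]_(Hs n),
     (forall m, m \in M -> (c m *: weyl m) *m psi = psi) <->
     exists a : 'cV[C]_K, psi = W *m a).

(* probability distribution on V *)
Definition is_distr n (Pr : V n -> R) : Prop :=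
  (forall v, 0 <= Pr v) /\ \sum_(v : V n) Pr v = 1.

(* Pr(s,l) = sum_{m in M} Pr(s+l+m) *)
Definition Pr_sl n (Pr : V n -> R) (M : {set V n}) (s l : V n) : R :=
  \sum_(m in M) Pr (vadd (vadd s l) m).

(* success probability of maximum-likelihood decoding *)
Definition Psucc n (Pr : V n -> R) (M L S : {set V n}) : R :=
  \sum_(s in S) \big[Num.max/0]_(l in L) Pr_sl Pr M s l.

(* matrix logarithm (via the spectral decomposition of a normal matrix;
   the eigenvalue 0 is mapped to ln 0, whose value is irrelevant in the
   relative entropy under the support condition) and relative entropy *)
Definition mxlog m (A : 'M[C]_m) : 'M[C]_m :=
  invmx (spectralmx A) *m
  diag_mx (map_mx (fun z : C => (ln (complex.Re z))%:C) (spectral_diag A)) *m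
  spectralmx A.

Definition rel_entropy m (A B : 'M[C]_m) : R :=
  complex.Re (\tr (A *m (mxlog A - mxlog B))).

(* matrix indexed by a finite type *)
Definition fmx (I : finType) (f : I -> I -> C) : 'M[C]_(#|{: I}|) :=
  \matrix_(i, j) f (enum_val i) (enum_val j).

(* Kraus operators E_u = sqrt(Pr u) T(u) *)
Definition kraus n (Pr : V n -> R) (u : V n) : 'M[C]_(Hs n) :=
  (Num.sqrt (Pr u))%:C *: weyl u.

(* AQEC matrices Lambda + B and Lambda, rows (u,q1), columns (v,q2) *)
Definition LamB n (Pr : V n -> R) K (W : 'M[C]_(Hs n, K)) :=
  fmx (fun a b : (V n * 'I_K)%type =>
         (W ^t* *m (kraus Pr a.1) ^t* *m kraus Pr b.1 *m W) a.2 b.2 / K%:R).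

Definition lambda n (Pr : V n -> R) K (W : 'M[C]_(Hs n, K)) (u v : V n) : C :=
  \tr ((W *m W ^t*) *m (kraus Pr u) ^t* *m kraus Pr v *m (W *m W ^t*)) / K%:R.

Definition Lam n (Pr : V n -> R) K (W : 'M[C]_(Hs n, K)) :=
  fmx (fun a b : (V n * 'I_K)%type =>
         lambda Pr W a.1 b.1 * (a.2 == b.2)%:R / K%:R).

Definition aqec_entropy n (Pr : V n -> R) K (W : 'M[C]_(Hs n, K)) : R :=
  rel_entropy (LamB Pr W) (Lam Pr W).

End QECDefs.

(* Main.v *)
(** Write [P(u)] and [p(u)] for the probabilities of the cosets [u + M^perp]
    (the syndrome) and [u + M].  The Gram matrix [A = Lambda + B] satisfies
    [A^2 = A diag(P/K)], because [T(w) P T(w)^*] is the projector onto the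
    syndrome space of [w]; likewise [Lambda^2 = Lambda diag(p/K)], because
    errors differing by an element of [M] act on the code space as multiples
    of each other, while [tr (P T(x)) = 0] for [x] outside [M].  Thus the
    columns of both matrices are eigenvectors, the logarithms are explicit,
    and the relative entropy is the conditional entropy
    [sum_u Pr(u) (ln P(u) - ln p(u))] of the logical class given the syndrome.
    It is at least [1 - Psucc] since [- ln x >= 1 - x], and Fano's inequality
    bounds it above, with [#|L| <= K^2] classes because the logical operators
    are trace-orthogonal [K x K] matrices. *)
Require Import Defs.
From HB Require Import structures.
From mathcomp Require Import all_boot all_order all_algebra.
From mathcomp Require Import spectral sesquilinear complex.
From mathcomp Require Import all_classical all_reals exp trigo topology normedtype sequences.
From mathcomp Require Import ring lra.
Import Order.TTheory GRing.Theory Num.Theory numFieldNormedType.Exports.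
Local Open Scope ring_scope.
Local Open Scope classical_set_scope.

Set Implicit Arguments.
Unset Strict Implicit.
Unset Printing Implicit Defensive.

(** * Entropy of a finite family of weights against its largest weight *)

Lemma bigmax_attained (R : realType) (I : finType) (A : {set I}) (p : I -> R) :
  A != finset.set0 -> (forall i, 0 <= p i) ->
  exists2 i0, i0 \in A & \big[Num.max/0]_(i in A) p i = p i0 /\
    forall i, i \in A -> p i <= p i0.
Proof.
case/set0Pn=> a aA p0.
case: (@Order.TotalTheory.arg_maxP _ _ I a (mem A) p aA) => i0 i0A hmax.
exists i0 => //; split; last exact: hmax.
apply/eqP; rewrite eq_le; apply/andP; split; last exact: le_bigmax_cond.
by apply/bigmax_leP; split => //.
Qed.

Section Entropy.
Variables (R : realType) (I : finType) (A : {set I}) (p : I -> R).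
Hypothesis p_ge0 : forall i, 0 <= p i.
Hypothesis A_neq0 : A != finset.set0.
Local Notation tot := (\sum_(i in A) p i).
Local Notation pmax := (\big[Num.max/0]_(i in A) p i).

Lemma le_sum_set i : i \in A -> p i <= tot.
Proof. by move=> iA; rewrite (bigD1 i) //= lerDl sumr_ge0. Qed.

(** With x = [p i / tot], the inequality -ln x >= 1 - x and maximality bound the [i]-th term below
    by [p i * (1 - pmax / tot)]; these bounds add up to [tot - pmax]. If [tot] is 0, both sides
    vanish. *)
Lemma entropy_ge_max : tot - pmax <= \sum_(i in A) p i * (ln tot - ln (p i)).
Proof.
have [i0 i0A [-> hmax]] := bigmax_attained A_neq0 p_ge0.
have tot_ge0 : 0 <= tot by apply: sumr_ge0.
have [tot0|totN0] := eqVneq tot 0.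
  have z i : i \in A -> p i = 0.
    by move=> iA; apply/eqP; rewrite eq_le p_ge0 andbT -tot0 le_sum_set.
  rewrite tot0 z // subrr big1 // => i iA; by rewrite z // mul0r.
have tot_gt0 : 0 < tot by rewrite lt_neqAle eq_sym totN0.
rewrite [leLHS](_ : _ = \sum_(i in A) (p i * (1 - p i0 / tot))); last first.
  rewrite -mulr_suml mulrBr mulr1; congr (_ - _); field.
  exact: totN0.
apply: ler_sum => i iA.
have [->|piN0] := eqVneq (p i) 0; first by rewrite !mul0r.
have pi_gt0 : 0 < p i by rewrite lt_neqAle eq_sym piN0 p_ge0.
rewrite ler_pM2l //.
have h : 1 - p i / tot <= ln tot - ln (p i).
  have : ln (1 + (p i / tot - 1)) <= p i / tot - 1.
    by apply: le_ln1Dx; have := divr_gt0 pi_gt0 tot_gt0; lra.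
  rewrite addrC subrK ln_div ?posrE //; lra.
apply: le_trans h; rewrite lerD2l lerN2 ler_pM2r ?invr_gt0 //; exact: hmax.
Qed.

(* Gibbs' inequality against the weights [1 - t] at a most likely outcome
   and [t / #|A|] elsewhere. *)
Lemma entropy_le_fano (t : R) : 0 < t < 1 ->
  \sum_(i in A) p i * (ln tot - ln (p i)) <=
  pmax * - ln (1 - t) + (tot - pmax) * (ln #|A|%:R - ln t).
Proof.
move=> /andP[t0 t1].
have [i0 i0A [-> hmax]] := bigmax_attained A_neq0 p_ge0.
have A_gt0 : 0 < #|A|%:R :> R by rewrite ltr0n card_gt0.
have tot_ge0 : 0 <= tot by apply: sumr_ge0.
pose q i := if i == i0 then 1 - t else t / #|A|%:R.
have q_gt0 i : 0 < q i by rewrite /q; case: eqP => _; [lra|exact: divr_gt0].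
(* Only [#|A| - 1] outcomes carry [t / #|A|], so the weights form a subprobability; Gibbs'
   inequality needs no more. *)
have q_sum : \sum_(i in A) q i <= 1.
  rewrite (bigD1 i0) //= {1}/q eqxx.
  rewrite (eq_bigr (fun _ => t / #|A|%:R)); last first.
    by move=> i /andP[_ /negPf]; rewrite /q => ->.
  have : \sum_(i in A | i != i0) (t / #|A|%:R) <= t.
    rewrite [leRHS](_ : _ = \sum_(i in A) (t / #|A|%:R)); last first.
      rewrite sumr_const -mulr_natr; field; exact: lt0r_neq0.
    rewrite [leRHS](bigD1 i0) //= lerDr; apply/ltW/divr_gt0 => //.
  lra.
have -> : p i0 * - ln (1 - t) + (tot - p i0) * (ln #|A|%:R - ln t) =
    \sum_(i in A) p i * - ln (q i).
  rewrite [in RHS](bigD1 i0) //= {1}/q eqxx; congr (_ + _).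
  rewrite (bigD1 i0) //= addrAC subrr add0r mulr_suml.
  apply: eq_bigr => i /andP[_ /negPf]; rewrite /q => ->.
  by rewrite ln_div ?posrE // opprB.
rewrite -subr_le0 -sumrB.
(* Termwise ln x <= x - 1 at x = [tot * q i / p i]; the resulting sum is at most 0 because the [q i]
   add up to at most 1. *)
apply: (@le_trans _ _ (\sum_(i in A) (tot * q i - p i))).
  apply: ler_sum => i iA.
  have [->|piN0] := eqVneq (p i) 0.
    by rewrite !mul0r !subr0 mulr_ge0 // ltW.
  have pi_gt0 : 0 < p i by rewrite lt_neqAle eq_sym piN0 p_ge0.
  have tot_gt0 : 0 < tot by apply: (lt_le_trans pi_gt0); exact: le_sum_set.
  have h : ln (1 + (tot * q i / p i - 1)) <= tot * q i / p i - 1.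
    apply: le_ln1Dx.
    have := divr_gt0 (mulr_gt0 tot_gt0 (q_gt0 i)) pi_gt0; lra.
  rewrite addrC subrK ln_div ?posrE ?mulr_gt0 // lnM ?posrE // in h.
  rewrite -mulrBr opprK addrAC.
  have -> : tot * q i - p i = p i * (tot * q i / p i - 1) by field.
  by rewrite ler_pM2l.
rewrite sumrB -mulr_sumr subr_le0.
by rewrite -[leRHS]mulr1 ler_wpM2l.
Qed.
End Entropy.

(** * Logarithms of normal matrices whose columns are eigenvectors *)

Section SpectralCalculus.
Variable R : realType.
Local Notation C := R[i].
Local Open Scope complex_scope.
Local Open Scope ring_scope.
Local Open Scope sesquilinear_scope.

(** In the spectral basis, [x] has nonzero coordinates only where the diagonal entry equals [a], so
    a function applied to the diagonal multiplies [x] by its value at [a]. *)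
Lemma mxlog_eigen m (A : 'M[C]_m) (x : 'cV[C]_m) (a : C) :
  A \is normalmx -> A *m x = a *: x ->
  mxlog A *m x = (ln (complex.Re a))%:C *: x.
Proof.
move=> /orthomx_spectralP Aeq Ax.
rewrite /mxlog; set P := spectralmx A in Aeq *.
have Pu : P \in unitmx := spectral_unit A.
have Dy : diag_mx (spectral_diag A) *m (P *m x) = a *: (P *m x).
  rewrite scalemxAr -Ax; rewrite [in RHS]Aeq -!mulmxA mulKVmx //.
rewrite -!mulmxA.
suff -> : diag_mx (map_mx (fun z : C => (ln (complex.Re z))%:C) (spectral_diag A))
     *m (P *m x) = (ln (complex.Re a))%:C *: (P *m x).
  by rewrite -scalemxAr mulKmx.
apply/matrixP => i j; move/matrixP/(_ i j): Dy.
rewrite !mul_diag_mx !mxE => /eqP; rewrite -subr_eq0 -mulrBl mulf_eq0 subr_eq0.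
by case/orP => /eqP ->; rewrite ?mulr0.
Qed.

(* Each column of A is an eigenvector, and [ln 0 = 0] makes [mxlog A] vanish
   on the kernel of [A]. *)
Lemma mxlog_sq m (A : 'M[C]_m) (h : 'rV[R]_m) :
  A \is normalmx -> (forall j, h 0 j = 0 -> col j A = 0) ->
  (forall i j, (A *m A) i j = A i j * (h 0 j)%:C) ->
  forall i j, mxlog A i j = A i j * (ln (h 0 j) / h 0 j)%:C.
Proof.
move=> An h0 AA.
have mAA i j : (mxlog A *m A) i j = A i j * (ln (h 0 j))%:C.
  have Acol : A *m col j A = (h 0 j)%:C *: col j A.
    by apply/matrixP => k l; rewrite !colE mulmxA -!colE mxE AA !mxE mulrC.
  have /matrixP/(_ i 0) := mxlog_eigen An Acol.
  by rewrite !colE mulmxA -!colE => hk; move: hk; rewrite mxE => ->; rewrite !mxE mulrC.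
(* [D] inverts [h] entrywise with 0^-1 = 0. From [A *m A] = A diag(h), the columns of 1 - A D lie in
   the kernel of [A] (where [h] vanishes, so does the column of [A]). Hence [mxlog A] kills them,
   and [mxlog A] = [mxlog A *m A *m D]. *)
pose D : 'M[C]_m := diag_mx (map_mx (fun x : R => (x^-1)%:C) h).
have kerA : A *m (1%:M - A *m D) = 0 *: (1%:M - A *m D).
  rewrite scale0r mulmxBr mulmx1 mulmxA; apply/matrixP => i j.
  rewrite mul_mx_diag [LHS]mxE [X in _ + X]mxE [X in - X]mxE [map_mx _ _ _ _]mxE AA [RHS]mxE.
  have [hj|hj] := eqVneq (h 0 j) 0; last first.
    by rewrite -mulrA -rmorphM mulfV // rmorph1 mulr1 subrr.
  by have /matrixP/(_ i 0) := h0 j hj; rewrite !mxE => ->; rewrite !mul0r subrr.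
move=> i j.
have : mxlog A *m (1%:M - A *m D) = 0.
  apply/matrixP => k l.
  have kc : A *m col l (1%:M - A *m D) = 0 *: col l (1%:M - A *m D).
    by rewrite [col l _]colE mulmxA kerA !scale0r mul0mx.
  have /matrixP/(_ k 0) := mxlog_eigen An kc.
  by rewrite ln0 // scale0r [col l _]colE mulmxA -colE mxE => ->; rewrite !mxE.
rewrite mulmxBr mulmx1 mulmxA => /eqP; rewrite subr_eq0 => /eqP /matrixP/(_ i j) ->.
by rewrite mul_mx_diag [LHS]mxE [map_mx _ _ _ _]mxE mAA rmorphM mulrA.
Qed.

Lemma mxtrace_mxlog_sq m (A B : 'M[C]_m) (h : 'rV[R]_m) :
  A \is normalmx -> (forall j, h 0 j = 0 -> col j A = 0) ->
  (forall i j, (A *m A) i j = A i j * (h 0 j)%:C) ->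
  \tr (B *m mxlog A) = \sum_j (B *m A) j j * (ln (h 0 j) / h 0 j)%:C.
Proof.
move=> An h0 AA; apply: eq_bigr => j _; rewrite !mxE mulr_suml.
by apply: eq_bigr => k _; rewrite (@mxlog_sq _ _ h) // mulrA.
Qed.

Lemma sum_fmx (I : finType) (F : I -> C) :
  \sum_(j < #|{: I}|) F (enum_val j) = \sum_(x : I) F x.
Proof.
rewrite (reindex (fun j : 'I_#|{: I}| => enum_val j : I)) //=.
by apply: onW_bij; exact: enum_val_bij.
Qed.

Lemma fmx_mul (I : finType) (f g : I -> I -> C) :
  fmx f *m fmx g = fmx (fun x y => \sum_z f x z * g z y).
Proof.
apply/matrixP => i j; rewrite !mxE -[RHS]sum_fmx.
by apply: eq_bigr => k _; rewrite !mxE.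
Qed.

(** Covers both traces of the relative entropy: [g] is always Lambda + B, and [f] is Lambda + B or
    Lambda. *)
Lemma mxtrace_fmx_mxlog (I : finType) (f g : I -> I -> C) (h : I -> R) :
  (forall x y, f x y = (f y x)^*) ->
  (forall y, h y = 0 -> forall x, f x y = 0) ->
  (forall x y, \sum_z f x z * f z y = f x y * (h y)%:C) ->
  \tr (fmx g *m mxlog (fmx f)) =
  \sum_x (\sum_z g x z * f z x) * (ln (h x) / h x)%:C.
Proof.
move=> fH h0 ff.
rewrite (@mxtrace_mxlog_sq _ _ _ (\row_j h (enum_val j))).
- by rewrite fmx_mul -[RHS]sum_fmx; apply: eq_bigr => j _; rewrite !mxE.
- apply: hermitian_normalmx; apply/is_hermitianmxP.
  by rewrite expr0 scale1r; apply/matrixP => i j; rewrite !mxE fH.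
- by move=> j; rewrite mxE => hj; apply/matrixP => k l; rewrite !mxE h0.
- by move=> i j; rewrite fmx_mul !mxE ff.
Qed.
End SpectralCalculus.

(** * Weyl operators: the additive character, product law, commutation and trace *)

Lemma de_moivre (R : realType) (x : R) k :
  ((cos x +i* sin x) ^+ k = cos (x *+ k) +i* sin (x *+ k))%C.
Proof.
elim: k => [|k IHk]; first by rewrite expr0 !mulr0n cos0 sin0.
rewrite exprS IHk mulrS cosD sinD; simpc.
by congr (_ +i* _)%C; rewrite addrC.
Qed.

Lemma adjmxM (F : numClosedFieldType) m n p (A : 'M[F]_(m, n)) (B : 'M[F]_(n, p)) :
  ((A *m B) ^t* = B ^t* *m A ^t*)%sesqui.
Proof. by rewrite trmx_mul map_mxM. Qed.

Lemma adjmxZ (F : numClosedFieldType) m n (a : F) (A : 'M[F]_(m, n)) :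
  ((a *: A) ^t* = a^* *: A ^t*)%sesqui.
Proof. by apply/matrixP => i j; rewrite !mxE rmorphM. Qed.

Lemma norm1_neq0 (F : numDomainType) (a : F) : `|a| = 1 -> a != 0.
Proof. by move=> a1; rewrite -normr_gt0 a1. Qed.

Section Weyl.
Variables (R : realType) (d : nat).
Hypothesis d_prime : prime d.
Local Notation C := R[i].
Local Open Scope complex_scope.
Local Open Scope ring_scope.
Local Open Scope sesquilinear_scope.
Local Notation weyl := (@weyl R d _).

Definition chi (a : 'F_d) : C := omega R d ^+ val a.

(** The order of [omega] divides the prime [d]; order 1 would force cos (2 pi / d) = 1. *)
Lemma omega_prim : d.-primitive_root (omega R d).
Proof.
have d_gt0 := prime_gt0 d_prime.
have dR : 0 < (d%:R : R) by rewrite ltr0n.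
have w1 : omega R d ^+ d = 1.
  rewrite /omega de_moivre -[2 * pi / _ *+ d]mulr_natr divfK ?lt0r_neq0 // mulrC mulr_natr.
  by rewrite cos2pi sin2pi.
have [m mP m_d] := prim_order_exists d_gt0 w1.
have /primeP[_ /(_ m m_d) /orP[/eqP m1|/eqP md]] := d_prime; last by rewrite md in mP.
have := prim_expr_order mP; rewrite m1 expr1 => /(congr1 (@complex.Re R)) /= c1.
have pi0 := @pi_gt0 R.
have : 2 * pi / d%:R = 0 :> R.
  (* As d >= 2, the angle lies in [0, pi], where the cosine is injective. *)
  apply: cos_inj; [|by rewrite in_itv /= lexx ltW|by rewrite c1 cos0].
  rewrite in_itv /= ltW ?divr_gt0 ?mulr_gt0 //= ler_pdivrMr // mulrC ler_pM2l //.
  by rewrite ler_nat prime_gt1.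
by move=> /eqP; rewrite gt_eqF // divr_gt0 // mulr_gt0.
Qed.

Lemma chiD a b : chi (a + b) = chi a * chi b.
Proof.
rewrite /chi -exprD; apply/eqP; rewrite (eq_prim_root_expr omega_prim).
rewrite (_ : val (a + b) = ((val a + val b) %% d)%N) ?modn_mod //.
by congr (_ %% _)%N; exact: Fp_cast.
Qed.

Lemma chi0 : chi 0 = 1. Proof. by rewrite /chi expr0. Qed.

Lemma chi_eq1 a : (chi a == 1) = (a == 0).
Proof.
rewrite /chi -(expr0 (omega R d)) (eq_prim_root_expr omega_prim) mod0n.
by rewrite modn_small // -[X in (_ < X)%N](Fp_cast d_prime) ltn_ord.
Qed.

Lemma norm_omega : `|omega R d| = 1.
Proof. by rewrite normc_def /= cos2Dsin2 sqrtr1. Qed.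

Lemma norm_chi a : `|chi a| = 1.
Proof. by rewrite /chi normrX norm_omega expr1n. Qed.

Lemma dotFDl n (a b e : 'rV['F_d]_n) : dotF (a + b) e = dotF a e + dotF b e.
Proof. by rewrite /dotF mulmxDl mxE. Qed.

Lemma dotFZl n (a : 'F_d) (b e : 'rV['F_d]_n) : dotF (a *: b) e = a * dotF b e.
Proof. by rewrite /dotF -scalemxAl mxE. Qed.

Lemma dotF0l n (e : 'rV['F_d]_n) : dotF 0 e = 0.
Proof. by rewrite /dotF mul0mx mxE. Qed.

Lemma dotFC n (a b : 'rV['F_d]_n) : dotF a b = dotF b a.
Proof. by rewrite /dotF -[a *m _]trmxK trmx_mul trmxK mxE. Qed.

Lemma dotFBr n (a b e : 'rV['F_d]_n) : dotF e (a - b) = dotF e a - dotF e b.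
Proof. by rewrite /dotF linearB mulmxBr !mxE. Qed.

Lemma dotF_delta n (a : 'rV['F_d]_n) i : dotF a (delta_mx 0 i) = a 0 i.
Proof. by rewrite /dotF trmx_delta -colE mxE. Qed.

Lemma vaddE n (u v : V d n) : vadd u v = u + v. Proof. by []. Qed.

Lemma symp0l n (v : V d n) : symp 0 v = 0.
Proof. by rewrite /symp /= !dotF0l subrr. Qed.

Lemma sympDl n (u v w : V d n) : symp (u + v) w = symp u w + symp v w.
Proof. by rewrite /symp /= !dotFDl; ring. Qed.

Lemma sympZl n a (u w : V d n) : symp (vscale a u) w = a * symp u w.
Proof. by rewrite /symp /= !dotFZl; ring. Qed.

Lemma symp_nondegenerate n (v : V d n) : v != 0 -> exists u, symp v u != 0.
Proof.
case: v => x z; rewrite -pair_eqE /= negb_and => /orP[] /eqP/rowP h.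
  have [i /eqP hi] : exists i, x 0 i <> 0 by apply/existsNP => h'; apply: h => i; rewrite h' mxE.
  by exists (0, delta_mx 0 i); rewrite /symp /= dotF_delta [dotF z 0]dotFC dotF0l subr0.
have [i /eqP hi] : exists i, z 0 i <> 0 by apply/existsNP => h'; apply: h => i; rewrite h' mxE.
exists (delta_mx 0 i, 0); rewrite /symp /= dotF_delta [dotF x 0]dotFC dotF0l sub0r.
by rewrite oppr_eq0.
Qed.

Definition weyl_coef n (v : V d n) (y' y : 'rV['F_d]_n) : C :=
  if y' == y + v.1 then chi (dotF v.2 y') else 0.

Lemma weyl_fmx n (v : V d n) : weyl v = fmx (weyl_coef v).
Proof. by []. Qed.

Lemma fmx1 (I : finType) : fmx (fun x y : I => (x == y)%:R : C) = 1%:M.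
Proof. by apply/matrixP => i j; rewrite !mxE (inj_eq enum_val_inj). Qed.

Lemma weylM n (u v : V d n) :
  weyl u *m weyl v = chi (- dotF v.2 u.1) *: weyl (u + v).
Proof.
rewrite !weyl_fmx fmx_mul; apply/matrixP => i j; rewrite !mxE.
set x := enum_val i; set y := enum_val j.
(* Each row of a Weyl matrix has a single nonzero entry, so one intermediate index survives. *)
rewrite (bigD1 (x - u.1)) //= big1 ?addr0 => [|z zN]; last first.
  rewrite /weyl_coef; case: eqP => [xE|]; last by rewrite mul0r.
  by rewrite xE addrK eqxx in zN.
rewrite /weyl_coef subrK eqxx subr_eq -addrA [v.1 + u.1]addrC /=.
case: eqP => // _; last by rewrite !mulr0.
by rewrite -!chiD; congr chi; rewrite dotFDl dotFBr; ring.
Qed.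

Lemma weyl_unitary n (v : V d n) : (weyl v)^t* *m weyl v = 1%:M.
Proof.
have -> : (weyl v)^t* = fmx (fun x y => (weyl_coef v y x)^*).
  by apply/matrixP => i j; rewrite !mxE.
rewrite weyl_fmx fmx_mul -fmx1; apply/matrixP => i j; rewrite !mxE.
set x := enum_val i; set y := enum_val j.
rewrite (bigD1 (x + v.1)) //= big1 ?addr0 => [|z /negPf zN]; last first.
  by rewrite /weyl_coef zN conjC0 mul0r.
rewrite /weyl_coef eqxx (inj_eq (addIr _)).
by case: eqP => _; rewrite ?mulr0 // mulrC -normCK norm_chi expr1n.
Qed.

Lemma weyl_unitaryr n (v : V d n) : weyl v *m (weyl v)^t* = 1%:M.
Proof. exact/mulmx1C/weyl_unitary. Qed.

Lemma weyl_phase n (u v : V d n) :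
  exists2 a : C, `|a| = 1 & weyl (u + v) = a *: (weyl u *m weyl v).
Proof.
exists (chi (dotF v.2 u.1)); first exact: norm_chi.
by rewrite weylM scalerA -chiD addrN chi0 scale1r.
Qed.

Lemma weyl_adj_mul n (u v : V d n) :
  exists2 a : C, `|a| = 1 & (weyl u)^t* *m weyl v = a *: weyl (v - u).
Proof.
have [a a1 h] := weyl_phase u (v - u); exists a => //.
by rewrite addrC subrK in h; rewrite h -scalemxAr mulmxA weyl_unitary mul1mx.
Qed.

Lemma weylC n (u v : V d n) :
  weyl u *m weyl v = chi (symp v u) *: (weyl v *m weyl u).
Proof.
rewrite !weylM scalerA -chiD [u + v]addrC /symp.
by congr (chi _ *: _); rewrite [dotF v.1 _]dotFC; ring.
Qed.

(** Conjugation by a [weyl u] with [symp v u] nonzero preserves the trace but multiplies [weyl v] by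
    a character value different from 1. *)
Lemma mxtrace_weyl n (v : V d n) : v != 0 -> \tr (weyl v) = 0.
Proof.
case/symp_nondegenerate => u hu.
have : \tr (weyl u *m weyl v *m (weyl u)^t*) = \tr (weyl v).
  by rewrite mxtrace_mulC mulmxA weyl_unitary mul1mx.
rewrite weylC -scalemxAl -mulmxA weyl_unitaryr mulmx1 mxtraceZ => /eqP.
rewrite -subr_eq0 -[X in _ - X]mul1r -mulrBl mulf_eq0 subr_eq0 chi_eq1.
by rewrite (negPf hu) => /eqP.
Qed.
End Weyl.

(** * Action of Weyl operators on the code space *)

Section StabilizerCode.
Variables (R : realType) (d : nat).
Hypothesis d_prime : prime d.
Local Notation C := R[i].
Local Open Scope complex_scope.
Local Open Scope ring_scope.
Local Open Scope sesquilinear_scope.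
Local Notation weyl := (@weyl R d _).
Variables (n : nat) (M : {set V d n}) (c : V d n -> C).
Variables (K : nat) (W : 'M[C]_(Hs d n, K)).
Hypothesis M_stab : stab_group M c.
Hypothesis W_basis : code_basis M c W.

Lemma M_subspace : is_subspace M. Proof. by case: M_stab. Qed.

Lemma subspace0 (A : {set V d n}) : is_subspace A -> (0 : V d n) \in A.
Proof. by case/and3P. Qed.

Lemma subspaceD (A : {set V d n}) (u v : V d n) : is_subspace A ->
  u \in A -> v \in A -> u + v \in A.
Proof.
by case/and3P => _ /forall_inP h _ uA vA; have /forall_inP := h u uA; exact.
Qed.

Lemma vscaleN1 (u : V d n) : vscale (-1) u = - u.
Proof. by rewrite /vscale !scaleN1r. Qed.

Lemma subspaceN (A : {set V d n}) u : is_subspace A ->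
  u \in A -> (- u : V d n) \in A.
Proof.
case/and3P => _ _ /forallP/(_ (-1))/forall_inP h uA.
by rewrite -vscaleN1; exact: h.
Qed.

Lemma subspaceB (A : {set V d n}) (u v : V d n) : is_subspace A ->
  u \in A -> v \in A -> u - v \in A.
Proof. by move=> sA uA vA; apply: subspaceD => //; exact: subspaceN. Qed.

Lemma subspaceDl (A : {set V d n}) (u v : V d n) : is_subspace A ->
  v \in A -> (u + v \in A) = (u \in A).
Proof.
move=> sA vA; apply/idP/idP => h; last exact: subspaceD.
by rewrite -(addrK v u); exact: subspaceB.
Qed.

Lemma subspace_subC (A : {set V d n}) (u v : V d n) : is_subspace A ->
  (u - v \in A) = (v - u \in A).
Proof.
by move=> sA; apply/idP/idP => h; rewrite -opprB; exact: subspaceN.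
Qed.

Lemma subspace_sperp (A : {set V d n}) : is_subspace (sperp A).
Proof.
apply/and3P; split.
- by rewrite inE; apply/forall_inP => m _; rewrite symp0l.
- apply/forall_inP => u; rewrite inE => /forall_inP hu.
  apply/forall_inP => v; rewrite inE => /forall_inP hv.
  rewrite inE; apply/forall_inP => m mA.
  by rewrite vaddE sympDl (eqP (hu m mA)) (eqP (hv m mA)) addr0.
- apply/forallP => a; apply/forall_inP => u; rewrite inE => /forall_inP hu.
  by rewrite inE; apply/forall_inP => m mA; rewrite sympZl (eqP (hu m mA)) mulr0.
Qed.

Lemma norm_c m : m \in M -> `|c m| = 1.
Proof. by case: M_stab => _ [_ [h _]]; exact: h. Qed.

Lemma W_iso : W^t* *m W = 1%:M. Proof. by case: W_basis. Qed.

(** Applies [code_basis] column by column, replacing the fixed-vector condition by an identity for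
    the projector [W *m W^t*]. *)
Lemma in_code_space p (X : 'M[C]_(Hs d n, p)) :
  (forall m, m \in M -> (c m *: weyl m) *m X = X) <-> W *m W^t* *m X = X.
Proof.
split=> [fixX|WX m mM].
  apply/matrixP => i j; have [a aE] : exists a, col j X = W *m a.
    case: W_basis => _ h; apply/h => m mM.
    by rewrite !colE mulmxA fixX.
  have /matrixP/(_ i 0) : W *m W^t* *m col j X = col j X.
    by rewrite aE -mulmxA (mulmxA _ W) W_iso mul1mx.
  by rewrite !colE mulmxA -!colE [LHS]mxE [RHS]mxE.
suff WE : (c m *: weyl m) *m W = W by rewrite -WX !mulmxA WE.
apply/matrixP => i j.
have /matrixP/(_ i 0) : (c m *: weyl m) *m col j W = col j W.
  case: W_basis => _ h; apply: ((h (col j W)).2 _ m mM).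
  by exists (delta_mx j 0); rewrite colE.
by rewrite !colE mulmxA -!colE [LHS]mxE [RHS]mxE.
Qed.

Lemma stab_code m : m \in M -> (c m *: weyl m) *m W = W.
Proof. by apply: (in_code_space W).2; rewrite -mulmxA W_iso mulmx1. Qed.

(** A unitary that fixes the columns of [W] has an adjoint that fixes them too. *)
Lemma stab_code_adj m : m \in M -> W^t* *m (c m *: weyl m) = W^t*.
Proof.
move=> mM; rewrite -[in LHS](stab_code mM) adjmxM -mulmxA.
rewrite adjmxZ -scalemxAl -[_ *m (c m *: _)]scalemxAr weyl_unitary // -scalemxAr.
rewrite -scalemxAr scalerA mulrC -normCK.
by rewrite norm_c // expr1n scale1r mulmx1.
Qed.

(** Some [m] in [M] has [symp x m] nonzero. Inserting its stabilizer on the left and commuting it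
    past [weyl x] multiplies the block by a character value different from 1. *)
Lemma code_orthogonal x : x \notin sperp M -> W^t* *m weyl x *m W = 0.
Proof.
rewrite inE negb_forall => /existsP[m]; rewrite negb_imply => /andP[mM xm].
have : W^t* *m weyl x *m W = chi R (symp x m) *: (W^t* *m weyl x *m W).
  have Ax : (c m *: weyl m) *m weyl x =
      chi R (symp x m) *: (weyl x *m (c m *: weyl m)).
    by rewrite -scalemxAl weylC // -scalemxAr scalerA mulrC -scalerA.
  rewrite -[X in X *m weyl x *m W = _](stab_code_adj mM) -(mulmxA _ _ (weyl x)) Ax.
  by rewrite -scalemxAr -scalemxAl mulmxA -(mulmxA _ _ W) stab_code.
move=> /eqP; rewrite -subr_eq0 -[X in X - _]scale1r -scalerBl scaler_eq0.
by rewrite subr_eq0 eq_sym chi_eq1 // (negPf xm) => /eqP.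
Qed.

(** [weyl x] commutes with the whole stabilizer group, hence preserves its fixed space. *)
Lemma code_stable x : x \in sperp M -> W *m W^t* *m (weyl x *m W) = weyl x *m W.
Proof.
rewrite inE => /forall_inP xM; apply/in_code_space => m mM.
rewrite -scalemxAl mulmxA weylC // (eqP (xM m mM)) chi0 scale1r.
by rewrite -mulmxA scalemxAr scalemxAl stab_code.
Qed.

(** Each stabilizer is absorbed by [W^t*], so the average P satisfies W W^* P = W W^*. Translating
    the sum by [m] shows that stabilizers fix the columns of P, so W W^* P = P as well. *)
Lemma code_proj_avg : W *m W^t* = #|M|%:R^-1 *: \sum_(m in M) c m *: weyl m.
Proof.
set P := _ *: _.
have M0 : #|M|%:R != 0 :> C.
  by rewrite pnatr_eq0 -lt0n; apply/card_gt0P; exists 0; exact: subspace0 M_subspace.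
have WP : W^t* *m P = W^t*.
  rewrite -scalemxAr mulmx_sumr (eq_bigr (fun=> W^t*)).
    by rewrite sumr_const -[W^t* *+ _]scaler_nat scalerA mulVf // scale1r.
  by move=> m mM; exact: stab_code_adj.
rewrite -[in LHS]WP mulmxA; apply/in_code_space => m mM.
rewrite -scalemxAr mulmx_sumr; congr (_ *: _).
case: M_stab => _ [_ [_ hom]].
rewrite [RHS](reindex_inj (addrI (m : V d n))) /=.
rewrite [RHS](eq_bigl (mem M)) => [|m']; last first.
  by rewrite addrC subspaceDl // M_subspace.
by apply: eq_bigr => m' m'M; rewrite hom.
Qed.

(** Expanding the code projector as the stabilizer average leaves multiples of traces of
    [weyl (m + x)], and m + x is never 0 for [x] outside [M]. *)
Lemma code_trace0 x : x \notin M -> \tr (W^t* *m weyl x *m W) = 0.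
Proof.
move=> xM; rewrite mxtrace_mulC mulmxA code_proj_avg -scalemxAl mulmx_suml.
rewrite mxtraceZ raddf_sum big1 ?mulr0 // => m mM /=.
rewrite -scalemxAl mxtraceZ weylM // mxtraceZ mxtrace_weyl // ?mulr0 //.
apply: contraNneq xM => mx0.
by rewrite -(addKr m x) mx0 addr0; exact: subspaceN M_subspace _.
Qed.

Lemma code_block_out (u w : V d n) : w - u \notin sperp M ->
  W^t* *m (weyl u)^t* *m weyl w *m W = 0.
Proof.
move=> h; have [a _ aE] := weyl_adj_mul R d_prime u w.
rewrite -(mulmxA _ _ (weyl w)) aE -scalemxAr -scalemxAl code_orthogonal ?scaler0 //.
Qed.

(** Errors [u] and [w] with the same syndrome send the code space to the same subspace, onto which
    T(w) W W^* T(w)^* projects. *)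
Lemma code_block_in (u w : V d n) : w - u \in sperp M ->
  weyl w *m W *m W^t* *m (weyl w)^t* *m weyl u *m W = weyl u *m W.
Proof.
rewrite subspace_subC ?subspace_sperp // => h.
have [a _ aE] := weyl_adj_mul R d_prime w u.
transitivity (weyl w *m (W *m W^t* *m ((weyl w)^t* *m weyl u *m W))).
  by rewrite !mulmxA.
rewrite [X in _ *m X](_ : _ = (weyl w)^t* *m weyl u *m W).
  by rewrite !mulmxA weyl_unitaryr mul1mx.
by rewrite aE -scalemxAl -scalemxAr code_stable.
Qed.

(** Up to a phase, T(w) is T(u) T(w - u), and on the code T(w - u) is the scalar inverse to
    [c (w - u)]. *)
Lemma code_degenerate (u w : V d n) : w - u \in M ->
  exists2 a : C, `|a| = 1 & weyl w *m W = a *: (weyl u *m W).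
Proof.
move=> h; have [a a1 aE] := weyl_phase R d_prime u (w - u).
have c1 := norm_c h.
exists (a * (c (w - u))^-1); first by rewrite normrM normfV a1 c1 invr1 mulr1.
rewrite -[in RHS](stab_code h) -!scalemxAl -!scalemxAr scalerA mulfVK ?norm1_neq0 //.
by rewrite mulmxA scalemxAl -aE addrC subrK.
Qed.

Lemma code_block_trace0 (u w : V d n) : w - u \notin M ->
  \tr (W^t* *m (weyl u)^t* *m weyl w *m W) = 0.
Proof.
move=> h; have [a _ aE] := weyl_adj_mul R d_prime u w.
rewrite -(mulmxA _ _ (weyl w)) aE -scalemxAr -scalemxAl mxtraceZ.
by rewrite code_trace0 ?mulr0.
Qed.

Lemma code_block_self u : W^t* *m (weyl u)^t* *m weyl u *m W = 1%:M.
Proof. by rewrite -(mulmxA _ _ (weyl u)) weyl_unitary // mulmx1 W_iso. Qed.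

(* The logical operators [W^* T(l) W], [l \in L], are orthogonal for the trace
   form on K x K matrices. *)
Lemma card_logical (L : {set V d n}) : (0 < K)%N -> is_subspace L ->
  L \subset sperp M -> L :&: M = [set v0 d n]%SET -> (#|L| <= K * K)%N.
Proof.
move=> K0 Ls LM LM0.
pose lop (l : V d n) := W^t* *m weyl l *m W.
have lop_tr l l' : l \in L -> l' \in L ->
    \tr ((lop l)^t* *m lop l') = K%:R * (l == l')%:R.
  move=> lL l'L.
  (* The code projector between the two factors drops out, since [l'] is in [sperp M]. *)
  have -> : (lop l)^t* *m lop l' = W^t* *m (weyl l)^t* *m weyl l' *m W.
    rewrite /lop !adjmxM trmxCK -!mulmxA; do 2!congr (_ *m _).
    by rewrite (mulmxA W) code_stable ?(fintype.subsetP LM).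
  case: eqP => [->|ll'] /=.
    by rewrite code_block_self mxtrace1 mulr1.
  rewrite mulr0; apply: code_block_trace0; apply/negP => h.
  have : l' - l \in L :&: M by rewrite inE subspaceB.
  by rewrite LM0 inE [_ == _]subr_eq0 eq_sym => /eqP.
(* [X] and [Y] list the flattened operators, so that [X *m Y^T] is their Gram matrix [K%:R%:M], of
   rank [#|L|]; its rank is at most the number [K * K] of columns of [X]. *)
pose X : 'M[C]_(#|L|, K * K) := \matrix_i mxvec ((lop (enum_val i))^t*)^T.
pose Y : 'M[C]_(#|L|, K * K) := \matrix_i mxvec (lop (enum_val i)).
have XY : X *m Y^T = K%:R%:M.
  apply/matrixP => i j; rewrite !mxE.
  transitivity (\tr ((lop (enum_val i))^t* *m lop (enum_val j))); last first.
    by rewrite lop_tr ?enum_valP // (inj_eq enum_val_inj) mulr_natr.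
  rewrite (reindex _ (curry_mxvec_bij _ _)) /=.
  rewrite (eq_bigr (fun p => X i (mxvec_index p.1 p.2) * Y^T (mxvec_index p.1 p.2) j));
    last by case.
  rewrite -(pair_bigA _ (fun a b => X i (mxvec_index a b) * Y^T (mxvec_index a b) j)) /=.
  rewrite exchange_big; apply: eq_bigr => a _; rewrite mxE; apply: eq_bigr => b _.
  by rewrite [X _ _]mxE [Y^T _ _]mxE [Y _ _]mxE !mxvecE [_^T _ _]mxE.
have := mxrankM_maxl X Y^T; rewrite XY -scalemx1 mxrank_scale_nz ?mxrank1; last first.
  by rewrite pnatr_eq0 -lt0n.
by move=> /leq_trans; apply; exact: rank_leq_col.
Qed.
End StabilizerCode.

(** * The AQEC matrices, and the relative entropy as a sum over errors *)

Lemma mxtrace_compress (F : numClosedFieldType) m k (W : 'M[F]_(m, k))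
    (A B : 'M_m) a b : (W^t* *m W = 1%:M ->
  \tr ((W *m W^t*) *m (a *: A)^t* *m (b *: B) *m (W *m W^t*)) =
  a^* * b * \tr (W^t* *m A^t* *m B *m W))%sesqui.
Proof.
move=> W1; rewrite adjmxZ -!(scalemxAl, scalemxAr) scalerA mxtraceZ.
by congr (_ * _); rewrite ?[b * _]mulrC // !mulmxA mxtrace_mulC !mulmxA W1 mul1mx.
Qed.

Lemma sum_delta (F : fieldType) (I : finType) (a b e : F) (p q : I) :
  \sum_r (a * (p == r)%:R / e) * (b * (r == q)%:R / e) =
  a * b * (p == q)%:R / e / e.
Proof.
rewrite (bigD1 p) //= big1 ?addr0 => [|r /negPf rp].
  by rewrite eqxx mulr1; ring.
by rewrite eq_sym rp mulr0 !mul0r.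
Qed.

Section EntropyFormula.
Variables (R : realType) (d : nat).
Hypothesis d_prime : prime d.
Local Notation C := R[i].
Local Open Scope complex_scope.
Local Open Scope ring_scope.
Local Open Scope sesquilinear_scope.
Local Notation weyl := (@weyl R d _).
Variables (n : nat) (M : {set V d n}) (c : V d n -> C).
Variables (K : nat) (W : 'M[C]_(Hs d n, K)) (Pr : V d n -> R).
Hypothesis K_gt0 : (0 < K)%N.
Hypothesis M_stab : stab_group M c.
Hypothesis W_basis : code_basis M c W.
Hypothesis Pr_distr : is_distr Pr.

Definition coset_pr (A : {set V d n}) (u : V d n) : R :=
  \sum_(w : V d n | w - u \in A) Pr w.

(** The Knill-Laflamme matrix of a pair of errors, without the factors sqrt(Pr). *)
Definition block (u v : V d n) : 'M[C]_K := W^t* *m (weyl u)^t* *m weyl v *m W.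

(** The scalar [lambda] without its factors sqrt(Pr). *)
Definition overlap (u v : V d n) : C := \tr (block u v) / K%:R.

Local Notation rt u := (Num.sqrt (Pr u))%:C.
Local Notation k := (K%:R : R).
Let KC : K%:R = k%:C :> C. Proof. by rewrite rmorph_nat. Qed.
Let k_neq0 : k != 0. Proof. by rewrite pnatr_eq0 -lt0n. Qed.
Let kC_neq0 : K%:R != 0 :> C. Proof. by rewrite pnatr_eq0 -lt0n. Qed.
Let Pr_ge0 u : 0 <= Pr u. Proof. by case: Pr_distr => h _. Qed.
Let rt2 u : rt u * rt u = (Pr u)%:C.
Proof. by rewrite -rmorphM -expr2 sqr_sqrtr. Qed.

Let rtJ u : (rt u)^* = rt u.
Proof. exact: conjc_real. Qed.

Let divkC x : (x / k)%:C = x%:C / K%:R :> C.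
Proof. by rewrite KC -fmorphV -rmorphM. Qed.

Let rt_conj u v (z : C) :
  (rt u * rt v * z / K%:R)^* = rt v * rt u * z^* / K%:R.
Proof. by rewrite !rmorphM /= fmorphV /= conjC_nat !rtJ [rt u * _]mulrC. Qed.

Lemma coset_pr_ge (A : {set V d n}) u : is_subspace A -> Pr u <= coset_pr A u.
Proof.
move=> As; rewrite /coset_pr (bigD1 u) /= ?subrr ?subspace0 //.
by rewrite lerDl sumr_ge0.
Qed.

(** Supplies the condition that a zero eigenvalue comes with a zero column: [Pr u] is at most the
    probability of its coset. *)
Lemma rt_coset0 (A : {set V d n}) u : is_subspace A ->
  coset_pr A u / k = 0 -> rt u = 0.
Proof.
move=> As /eqP; rewrite mulf_eq0 invr_eq0 (negPf k_neq0) orbF => /eqP h.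
have Pu : Pr u = 0 by apply/eqP; rewrite eq_le Pr_ge0 -h coset_pr_ge.
by rewrite Pu sqrtr0.
Qed.

Lemma block_adj u v : (block u v)^t* = block v u.
Proof. by rewrite /block !adjmxM !trmxCK !mulmxA. Qed.

Lemma block_self u : block u u = 1%:M.
Proof. exact: code_block_self W_basis u. Qed.

(** The product contains T(w) W W^* T(w)^*, which acts as the identity on T(v) W when [w] and [v]
    share a syndrome; otherwise [block w v] is 0. *)
Lemma block_mul u w v :
  block u w *m block w v = if w - v \in sperp M then block u v else 0.
Proof.
have assoc p1 p2 p3 p4 p5 p6 p7 p8 (A : 'M[C]_(p1, p2)) (B : 'M_(p2, p3))
    (D : 'M_(p3, p4)) (E : 'M_(p4, p5)) (F : 'M_(p5, p6)) (G : 'M_(p6, p7))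
    (H : 'M_(p7, p8)) p9 (J : 'M_(p8, p9)) :
    (A *m B *m D *m E) *m (F *m G *m H *m J) =
    (A *m B) *m (D *m E *m F *m G *m H *m J) by rewrite !mulmxA.
case: ifP => h.
  rewrite assoc -[RHS]mulmxA.
  exact: (congr1 (mulmx (W^t* *m (weyl u)^t*)) (code_block_in d_prime W_basis h)).
rewrite {2}/block (code_block_out d_prime M_stab) ?mulmx0 //.
by rewrite subspace_subC ?h //; exact: subspace_sperp.
Qed.

Lemma overlap_self u : overlap u u = 1.
Proof. by rewrite /overlap block_self mxtrace1 mulfV. Qed.

(** For w - v in [M], T(w) W = a T(v) W with |a| = 1, and the phase enters the two factors as a and
    its conjugate. Otherwise [overlap w v] is a vanishing trace. *)
Lemma overlap_mul u w v :
  overlap u w * overlap w v = if w - v \in M then overlap u v else 0.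
Proof.
have Ms := M_subspace M_stab.
case: ifPn => h; last first.
  rewrite [overlap w v](_ : _ = 0) ?mulr0 // /overlap /block.
  by rewrite (code_block_trace0 d_prime M_stab W_basis) ?mul0r // subspace_subC.
have [a a1 aE] := code_degenerate d_prime M_stab W_basis h.
have uw : block u w = a *: block u v.
  by rewrite /block -!mulmxA aE -!scalemxAr.
have wv : block w v = a^* *: 1%:M.
  by rewrite -block_adj -(block_self v) -[in RHS]block_adj -adjmxZ /block -!mulmxA aE -!scalemxAr.
rewrite /overlap uw wv !mxtraceZ mxtrace1 mulfK //.
by rewrite mulrC !mulrA [a^* * a]mulrC -normCK a1 expr1n mul1r.
Qed.

Lemma LamB_fmx : LamB Pr W = fmx (fun x y : V d n * 'I_K =>
  rt x.1 * rt y.1 * block x.1 y.1 x.2 y.2 / K%:R).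
Proof.
apply/matrixP => i j; rewrite [LHS]mxE [RHS]mxE; congr (_ / _).
set x := enum_val i; set y := enum_val j.
rewrite /kraus adjmxZ -!(scalemxAl, scalemxAr) scalerA mxE rtJ.
by rewrite [X in X * _ = _]mulrC.
Qed.

Lemma Lam_fmx : Lam Pr W = fmx (fun x y : V d n * 'I_K =>
  rt x.1 * rt y.1 * overlap x.1 y.1 * (x.2 == y.2)%:R / K%:R).
Proof.
apply/matrixP => i j; rewrite [LHS]mxE [RHS]mxE; congr (_ * _ / _).
set x := enum_val i; set y := enum_val j.
rewrite /lambda /overlap /kraus (mxtrace_compress _ _ _ _ (W_iso W_basis)) rtJ.
by rewrite mulrA.
Qed.
Lemma sum_pair_ord (F : V d n -> 'I_K -> C) :
  \sum_(z : V d n * 'I_K) F z.1 z.2 = \sum_w \sum_r F w r.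
Proof. by rewrite pair_bigA. Qed.

(** At 0 both sides vanish, by the default value [ln 0 = 0]. *)
Lemma mulr_ln_div (x : R) : x%:C * (ln x / x)%:C = (ln x)%:C.
Proof.
rewrite -rmorphM; have [->|x0] := eqVneq x 0; first by rewrite mul0r ln0.
by rewrite mulrC divfK.
Qed.

Lemma LamB_sq (x y : V d n * 'I_K) :
  \sum_(z : V d n * 'I_K)
    (rt x.1 * rt z.1 * block x.1 z.1 x.2 z.2 / K%:R) *
    (rt z.1 * rt y.1 * block z.1 y.1 z.2 y.2 / K%:R) =
  (rt x.1 * rt y.1 * block x.1 y.1 x.2 y.2 / K%:R) *
    (coset_pr (sperp M) y.1 / k)%:C.
Proof.
rewrite (sum_pair_ord (fun w r => (rt x.1 * rt w * block x.1 w x.2 r / K%:R) *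
    (rt w * rt y.1 * block w y.1 r y.2 / K%:R))).
transitivity (\sum_w rt x.1 * rt y.1 / K%:R / K%:R * ((Pr w)%:C *
    (block x.1 w *m block w y.1) x.2 y.2)).
  apply: eq_bigr => w _; rewrite -rt2 mxE !mulr_sumr; apply: eq_bigr => r _; field.
  exact: kC_neq0.
rewrite -mulr_sumr divkC /coset_pr rmorph_sum /=.
rewrite (eq_bigr (fun w => if w - y.1 \in sperp M
    then (Pr w)%:C * block x.1 y.1 x.2 y.2 else 0)); last first.
  by move=> w _; rewrite block_mul; case: ifP => // _; rewrite mxE mulr0.
rewrite -big_mkcond -mulr_suml /=; set s := \sum_(_ | _) _.
by field; exact: kC_neq0.
Qed.

Lemma Lam_sq (x y : V d n * 'I_K) :
  \sum_(z : V d n * 'I_K)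
    (rt x.1 * rt z.1 * overlap x.1 z.1 * (x.2 == z.2)%:R / K%:R) *
    (rt z.1 * rt y.1 * overlap z.1 y.1 * (z.2 == y.2)%:R / K%:R) =
  (rt x.1 * rt y.1 * overlap x.1 y.1 * (x.2 == y.2)%:R / K%:R) *
    (coset_pr M y.1 / k)%:C.
Proof.
rewrite (sum_pair_ord (fun w r =>
    (rt x.1 * rt w * overlap x.1 w * (x.2 == r)%:R / K%:R) *
    (rt w * rt y.1 * overlap w y.1 * (r == y.2)%:R / K%:R))).
transitivity (\sum_w rt x.1 * rt y.1 * (x.2 == y.2)%:R / K%:R / K%:R *
    ((Pr w)%:C * (overlap x.1 w * overlap w y.1))).
  apply: eq_bigr => w _; rewrite sum_delta -rt2.
  move: (rt _) (rt _) (rt _) (overlap _ _) (overlap _ _) (_ %:R) (_^-1) => *; ring.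
rewrite -mulr_sumr divkC /coset_pr rmorph_sum /=.
rewrite (eq_bigr (fun w => if w - y.1 \in M
    then (Pr w)%:C * overlap x.1 y.1 else 0)); last first.
  by move=> w _; rewrite overlap_mul; case: ifP => // _; rewrite mulr0.
rewrite -big_mkcond -mulr_suml /=; set s := \sum_(_ | _) _.
by field; exact: kC_neq0.
Qed.

Lemma trace_LamB_log : \tr (LamB Pr W *m mxlog (LamB Pr W)) =
  (\sum_u Pr u * ln (coset_pr (sperp M) u / k))%:C.
Proof.
rewrite LamB_fmx (@mxtrace_fmx_mxlog _ _ _ _ (fun x => coset_pr (sperp M) x.1 / k)).
(* Diagonal blocks are the identity, so each [u] contributes [K] equal terms weighted by
   [Pr u / K]. *)
- under eq_bigr => x _ do
    rewrite LamB_sq rt2 block_self mxE eqxx mulr1 -(mulrA (_ / _)) mulr_ln_div.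
  rewrite (sum_pair_ord (fun u q => (Pr u)%:C / K%:R * (ln (coset_pr (sperp M) u / k))%:C)).
  rewrite rmorph_sum; apply: eq_bigr => u _; rewrite sumr_const card_ord -mulr_natr rmorphM.
  by field; exact: kC_neq0.
- move=> x y; rewrite rt_conj; congr (_ * _ / _).
  by rewrite -(block_adj y.1 x.1) [LHS]mxE [_^T _ _]mxE.
- by move=> y /(rt_coset0 (subspace_sperp M)) h x; rewrite h mulr0 !mul0r.
- exact: LamB_sq.
Qed.

Lemma overlap_adj u v : (overlap u v)^* = overlap v u.
Proof.
rewrite /overlap -(block_adj u v) rmorphM fmorphV /= conjC_nat; congr (_ / _).
by rewrite rmorph_sum; apply: eq_bigr => i _; rewrite [RHS]mxE [_^T _ _]mxE.
Qed.

(** Lambda is scalar in the code index, so only the traces of the blocks of Lambda + B enter, and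
    these are [K] times the overlaps: B contributes nothing. *)
Lemma trace_LamB_log_Lam : \tr (LamB Pr W *m mxlog (Lam Pr W)) =
  (\sum_u Pr u * ln (coset_pr M u / k))%:C.
Proof.
have Ms := M_subspace M_stab.
rewrite LamB_fmx Lam_fmx (@mxtrace_fmx_mxlog _ _ _ _ (fun x => coset_pr M x.1 / k)).
- rewrite (sum_pair_ord (fun u q => (\sum_(z : V d n * 'I_K)
     rt u * rt z.1 * block u z.1 q z.2 / K%:R *
     (rt z.1 * rt u * overlap z.1 u * (z.2 == q)%:R / K%:R)) *
     (ln (coset_pr M u / k) / (coset_pr M u / k))%:C)).
  rewrite rmorph_sum; apply: eq_bigr => u _; rewrite -mulr_suml.
  under eq_bigr => q _.
    rewrite (sum_pair_ord (fun w r => rt u * rt w * block u w q r / K%:R *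
      (rt w * rt u * overlap w u * (r == q)%:R / K%:R))).
    over.
  rewrite exchange_big /=.
  transitivity ((\sum_w (Pr u)%:C / K%:R * ((Pr w)%:C * (overlap u w * overlap w u))) *
      (ln (coset_pr M u / k) / (coset_pr M u / k))%:C).
    congr (_ * _); apply: eq_bigr => w _.
    have -> : overlap u w = (\sum_q block u w q q) / K%:R by [].
    rewrite !(mulr_suml, mulr_sumr); apply: eq_bigr => q _.
    rewrite (bigD1 q) //= big1 ?addr0; last first.
      by move=> r /negPf ->; rewrite !(mulr0, mul0r).
    rewrite eqxx mulr1 -!rt2.
    move: (rt u) (rt w) (overlap w u) (block u w q q) (_^-1) => *; ring.
  rewrite -mulr_sumr (eq_bigr (fun w => if w - u \in M then (Pr w)%:C else 0)).
    rewrite -big_mkcond -rmorph_sum /= -/(coset_pr M u).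
    rewrite [RHS]rmorphM /= -(mulr_ln_div (_ / k)) divkC !mulrA.
    by congr (_ * _); rewrite mulrAC.
  by move=> w _; rewrite overlap_mul overlap_self; case: ifP; rewrite ?mulr1 ?mulr0.
- move=> x y; rewrite -[in RHS](mulrA _ (overlap _ _)) rt_conj rmorphM /= overlap_adj.
  by rewrite conjC_nat eq_sym [in RHS]mulrA.
- by move=> y /(rt_coset0 Ms) h x; rewrite h mulr0 !mul0r.
- exact: Lam_sq.
Qed.

Lemma aqec_entropyE : aqec_entropy Pr W =
  \sum_u Pr u * (ln (coset_pr (sperp M) u) - ln (coset_pr M u)).
Proof.
rewrite /aqec_entropy /rel_entropy mulmxBr raddfB /= trace_LamB_log trace_LamB_log_Lam.
rewrite -rmorphB /= -sumrB; apply: eq_bigr => u _; rewrite -mulrBr.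
(* When [Pr u] is positive, so are both coset probabilities; the logarithms then split and the two
   ln K cancel. *)
have [->|PuN0] := eqVneq (Pr u) 0; first by rewrite !mul0r.
have Pu : 0 < Pr u by rewrite lt_neqAle eq_sym PuN0 Pr_ge0.
have P1 := lt_le_trans Pu (coset_pr_ge u (subspace_sperp M)).
have P2 := lt_le_trans Pu (coset_pr_ge u (M_subspace M_stab)).
have k0 : 0 < k by rewrite ltr0n.
by rewrite !ln_div ?posrE //; congr (_ * _); ring.
Qed.
End EntropyFormula.

(** * Conditional entropy of the logical class, bounded through the decoder's success probability *)

Section MaximumLikelihood.
Variables (R : realType) (d : nat).
Hypothesis d_prime : prime d.
Variables (n : nat) (M L S : {set V d n}) (c : V d n -> R[i]).
Variables (K : nat) (W : 'M[R[i]]_(Hs d n, K)) (Pr : V d n -> R).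
Hypothesis K_gt0 : (0 < K)%N.
Hypothesis M_stab : stab_group M c.
Hypothesis W_basis : code_basis M c W.
Hypothesis Pr_distr : is_distr Pr.
Hypothesis L_dsum : is_dsum L M (sperp M).
Hypothesis S_dsum : is_dsum S (sperp M) [set: V d n]%SET.

Lemma sum_dsum (A B D : {set V d n}) (F : V d n -> R) : is_dsum A B D ->
  \sum_(u in D) F u = \sum_(a in A) \sum_(b in B) F (a + b).
Proof.
case/and4P => As Bs /eqP AB0 /eqP ->.
rewrite curry_imset2X big_imset /=; last first.
  move=> [a b] [a' b']; rewrite !finset.in_setX => /andP[/= aA bB] /andP[/= a'A b'B] /= e.
  have aa' : a - a' = b' - b.
    by apply: (addIr b); rewrite subrK addrAC; apply: (addIr a'); rewrite subrK [RHS]addrC.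
  have : a - a' \in A :&: B by rewrite inE subspaceB //= aa' subspaceB.
  rewrite AB0 inE => /eqP z; have aE : a = a' by apply/eqP; rewrite -subr_eq0; apply/eqP.
  by move: aa'; rewrite aE subrr => /esym/eqP; rewrite subr_eq0 => /eqP ->.
rewrite (pair_big_dep _ _ (fun a b : V d n => F (a + b))) /=.
by apply: eq_big => [[a b]|[a b] _] //=; rewrite finset.in_setX.
Qed.

Lemma coset_prD (A : {set V d n}) (u a : V d n) : is_subspace A -> a \in A ->
  coset_pr Pr A (u + a) = \sum_(m in A) Pr (u + m).
Proof.
move=> As aA; rewrite /coset_pr (reindex_inj (addrI u)) /=.
apply: eq_bigl => m; rewrite opprD addrACA subrr add0r.
by rewrite subspaceDl // subspaceN.
Qed.

Let ps (s l : V d n) : R := Pr_sl Pr M s l.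
Let Ms := M_subspace M_stab.
Let Ls : is_subspace L. Proof. by case/and4P: L_dsum. Qed.
Let Pr_ge0 u : 0 <= Pr u. Proof. by case: Pr_distr => h _. Qed.

Lemma Pr_sl_ge0 s l : 0 <= ps s l.
Proof. exact: sumr_ge0. Qed.

Lemma sum_syndrome (F : V d n -> R) :
  \sum_u F u = \sum_(s in S) \sum_(l in L) \sum_(m in M) F (s + (l + m)).
Proof.
transitivity (\sum_(u in [set: V d n]%SET) F u).
  by apply: eq_bigl => u; rewrite inE.
rewrite (sum_dsum _ S_dsum); apply: eq_bigr => s _.
exact: (sum_dsum (fun v => F (s + v)) L_dsum).
Qed.

Lemma sum_Pr_sl : \sum_(s in S) \sum_(l in L) ps s l = 1.
Proof.
case: Pr_distr => _ <-; rewrite sum_syndrome.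
apply: eq_bigr => s _; apply: eq_bigr => l _; apply: eq_bigr => m _.
by rewrite !vaddE addrA.
Qed.

(** At the error s + l + m, the coset of [sperp M] depends on [s] only and that of [M] on [s] and
    [l] only, so summing over [m] just collects [ps s l]. *)
Lemma conditional_entropyE : aqec_entropy Pr W =
  \sum_(s in S) \sum_(l in L) ps s l * (ln (\sum_(l' in L) ps s l') - ln (ps s l)).
Proof.
rewrite (aqec_entropyE d_prime K_gt0 M_stab W_basis Pr_distr) sum_syndrome.
apply: eq_bigr => s sS; apply: eq_bigr => l lL; rewrite [in RHS]/ps /Pr_sl mulr_suml.
apply: eq_bigr => m mM; rewrite !vaddE addrA; congr (_ * (ln _ - ln _)).
  rewrite -addrA coset_prD ?subspace_sperp //; last first.
    have /and4P[_ _ _ /eqP ->] := L_dsum.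
    by apply/imset2P; exists l m.
  rewrite (sum_dsum (fun v => Pr (s + v)) L_dsum).
  by apply: eq_bigr => l' _; apply: eq_bigr => m' _; rewrite !vaddE addrA.
by rewrite coset_prD.
Qed.

Let L_neq0 : L != finset.set0.
Proof. by apply/set0Pn; exists 0; exact: subspace0. Qed.

Lemma entropy_ge_Psucc : 1 - Psucc Pr M L S <= aqec_entropy Pr W.
Proof.
rewrite conditional_entropyE -sum_Pr_sl /Psucc -sumrB; apply: ler_sum => s _.
exact: entropy_ge_max (Pr_sl_ge0 s) L_neq0.
Qed.

Lemma Psucc_le1 : Psucc Pr M L S <= 1.
Proof.
rewrite -sum_Pr_sl; apply: ler_sum => s _.
have [l lL [-> _]] := bigmax_attained L_neq0 (Pr_sl_ge0 s).
exact: (@le_sum_set _ _ _ (ps s) (Pr_sl_ge0 s) l lL).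
Qed.

(** The Fano bound is linear in [pmax] and [tot], so with one [t] shared by all syndromes it sums to
    a bound in [Psucc]. *)
Lemma entropy_le_Psucc (t : R) : 0 < t < 1 ->
  aqec_entropy Pr W <=
  - ln (1 - t) + (1 - Psucc Pr M L S) * (ln (K * K)%:R - ln t).
Proof.
move=> t01.
apply: (@le_trans _ _ (Psucc Pr M L S * - ln (1 - t) +
    (1 - Psucc Pr M L S) * (ln #|L|%:R - ln t))).
  rewrite conditional_entropyE -[X in X - Psucc _ _ _ _]sum_Pr_sl /Psucc mulr_suml -sumrB mulr_suml -big_split /=.
  apply: ler_sum => s _.
  exact: (@entropy_le_fano _ _ _ (ps s) (Pr_sl_ge0 s) L_neq0 t t01).
have /andP[t0 t1] := t01.
have ln1t : ln (1 - t) <= 0 by apply: ln_le0; lra.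
have P1 := Psucc_le1.
apply: lerD; first by rewrite ler_piMl // oppr_ge0.
apply: ler_wpM2l; first by rewrite subr_ge0.
rewrite lerD2r ler_ln ?posrE ?ltr0n ?muln_gt0 ?K_gt0 ?card_gt0 // ler_nat.
have /and4P[_ _ /eqP LM0 /eqP LME] := L_dsum.
apply: (card_logical d_prime M_stab W_basis) => //.
apply/fintype.subsetP => l lL; rewrite LME; apply/imset2P; exists l (v0 d n) => //.
  exact: subspace0.
by rewrite vaddE addr0.
Qed.
End MaximumLikelihood.

(** * Limits along the family of codes *)

Theorem theorem2 (R : realType) (d : nat) (d_prime : prime d)
  (M L S : forall n : nat, {set V d n})
  (c : forall n : nat, V d n -> R[i])
  (W : forall n : nat, 'M[R[i]]_(Hs d n, d ^ kdim (M n)))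
  (Pr : forall n : nat, V d n -> R)
  (hstab : forall n, stab_group (M n) (c n))
  (hL : forall n, is_dsum (L n) (M n) (sperp (M n)))
  (hS : forall n, is_dsum (S n) (sperp (M n)) [set: V d n]%SET)
  (hW : forall n, code_basis (M n) (c n) (W n))
  (hPr : forall n, is_distr (Pr n)) :
  let Sn := fun n => aqec_entropy (Pr n) (W n) in
  let Ps := fun n => Psucc (Pr n) (M n) (L n) (S n) in
  let k := fun n => kdim (M n) in
  [/\ (Sn @ \oo --> (0:R)) -> (Ps @ \oo --> (1:R)),
      (exists B : nat, forall n, (k n <= B)%N) -> (Ps @ \oo --> (1:R)) -> (Sn @ \oo --> (0:R))
    & (forall B : nat, \forall n \near \oo, (B <= k n)%N) -> (Ps @ \oo --> (1:R)) ->
        ((fun n => Sn n / (k n)%:R) @ \oo --> (0:R))].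
Proof.
move=> Sn Ps k.
have K0 n : (0 < d ^ k n)%N by rewrite expn_gt0 prime_gt0.
have lnd_ge0 : 0 <= ln (d%:R : R) by rewrite ln_ge0 // ler1n prime_gt0.
have Ps1 n : Ps n <= 1 := Psucc_le1 (hPr n) (hL n) (hS n).
have SnP n : 1 - Ps n <= Sn n.
  exact (entropy_ge_Psucc d_prime (K0 n) (hstab n) (hW n) (hPr n) (hL n) (hS n)).
have Sn0 n : 0 <= Sn n by apply: le_trans (SnP n); rewrite subr_ge0.
have Fano (t : R) n : 0 < t < 1 ->
    Sn n <= - ln (1 - t) + (1 - Ps n) * ((k n)%:R * (2 * ln d%:R) - ln t).
  (* The class count enters through ln K^2, which is linear in [k n]: bounded in the second claim,
     absorbed by the division in the third. *)
  have lnK : ln ((d ^ k n * d ^ k n)%N%:R : R) = (k n)%:R * (2 * ln d%:R).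
    rewrite -expnD natrX lnXn ?ltr0n ?prime_gt0 // addnn -mul2n -[LHS]mulr_natl natrM.
    by rewrite [2 * _]mulrC mulrA.
  move=> t01; rewrite -lnK.
  exact (entropy_le_Psucc d_prime (K0 n) (hstab n) (hW n) (hPr n) (hL n) (hS n) t01).
have err0 : Ps @ \oo --> (1 : R) -> (fun n => 1 - Ps n) @ \oo --> (0 : R).
  by move=> h; rewrite -(subrr 1); apply: cvgB => //; exact: cvg_cst.
split.
- move=> S0; apply: (@squeeze_cvgr _ _ _ _ (fun n => 1 - Sn n) (fun=> 1)).
  + by near=> n; rewrite Ps1 andbT; have := SnP n; lra.
  + by rewrite -[X in _ --> X](subr0 1); apply: cvgB => //; exact: cvg_cst.
  + exact: cvg_cst.
- case=> B kB /err0 e0; apply/cvgrPdist_lt => e epos.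
  (* Chosen so that [- ln (1 - t)] is exactly e/2; with [t] fixed, the rest of the Fano bound is at
     most 1 - Ps times the constant [A]. *)
  pose t : R := 1 - expR (- (e / 2)).
  have t01 : 0 < t < 1.
    have h1 : expR (- (e / 2)) < 1 by rewrite expR_lt1; lra.
    by have h2 := expR_gt0 (- (e / 2)); rewrite /t; lra.
  have lnt : - ln (1 - t) = e / 2 by rewrite /t subKr expRK opprK.
  pose A : R := B%:R * (2 * ln d%:R) - ln t.
  have eA : (fun n => (1 - Ps n) * A) @ \oo --> (0 : R).
    by rewrite -[X in _ --> X](mul0r A); apply: cvgM => //; exact: cvg_cst.
  have e2 : 0 < e / 2 by lra.
  have /cvgrPdist_lt/(_ _ e2) := eA.
  apply: filterS => n; rewrite !sub0r !normrN => h.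
  rewrite ger0_norm //; apply: (le_lt_trans (Fano t n t01)); rewrite lnt.
  have h' : (1 - Ps n) * ((k n)%:R * (2 * ln d%:R) - ln t) <= (1 - Ps n) * A.
    apply: ler_wpM2l; first by rewrite subr_ge0.
    rewrite lerD2r; apply: ler_wpM2r; last by rewrite ler_nat kB.
    by rewrite mulr_ge0.
  have := le_lt_trans (ler_norm _) h; lra.
- move=> koo /err0 e0; apply/cvgrPdist_lt => e epos.
  (* Here t = 1/2 is enough. [C] bounds the part of the Fano bound that does not grow with [k n],
     using 1 - Ps <= 1; divided by [k n] it becomes small. *)
  pose C : R := - ln (1 - 2^-1) - ln 2^-1.
  have half : 0 < (2^-1 : R) < 1 by lra.
  have ln2 : ln (2^-1 : R) <= 0 by apply: ln_le0; lra.
  have e2 : 0 < e / 2 by lra.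
  have eD : (fun n => (1 - Ps n) * (2 * ln d%:R)) @ \oo --> (0 : R).
    by rewrite -[X in _ --> X](mul0r (2 * ln d%:R)); apply: cvgM => //; exact: cvg_cst.
  have [N NC] : exists N : nat, C / (e / 2) < N%:R.
    by exists (Num.bound `|C / (e / 2)|); exact: le_lt_trans (ler_norm _) (archi_boundP (normr_ge0 _)).
  have /cvgrPdist_lt/(_ _ e2) hD := eD.
  near=> n.
  (* [N] makes [C] smaller than k e/2, and 1 keeps the divisor positive. *)
  have kN : (maxn N 1 <= k n)%N by near: n; exact: koo.
  have hDn : `|0 - (1 - Ps n) * (2 * ln d%:R)| < e / 2 by near: n; exact: hD.
  have k0 : 0 < (k n)%:R :> R by rewrite ltr0n; apply: leq_trans kN; rewrite leq_maxr.
  have kNR : (N%:R : R) <= (k n)%:R.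
    by rewrite ler_nat; apply: leq_trans kN; rewrite leq_maxl.
  rewrite sub0r normrN ger0_norm ?divr_ge0 ?ler0n ?Sn0 // ltr_pdivrMr //.
  apply: (le_lt_trans (Fano _ n half)).
  have hC : C < (k n)%:R * (e / 2).
    by rewrite -ltr_pdivrMr //; exact: lt_le_trans NC kNR.
  have hDk : (k n)%:R * ((1 - Ps n) * (2 * ln d%:R)) <= (k n)%:R * (e / 2).
    rewrite ler_pM2l //; rewrite sub0r normrN in hDn.
    by apply/ltW; exact: le_lt_trans (ler_norm _) hDn.
  have hP : (1 - Ps n) * - ln 2^-1 <= - ln (2^-1 : R).
    apply: ler_piMl; first by rewrite oppr_ge0.
    have : 0 <= Ps n.
      apply: sumr_ge0 => s _; exact: bigmax_ge_id.
    lra.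
  rewrite /C in hC; nra.
Unshelve. all: by end_near.
Qed.
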